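(* A fuzzy incidence graph $X$ is a strong fuzzy incidence graph if and only if every cycle in $X$ is a weak fuzzy incidence cycle.
   Context: Fuzzy incidence graphs. All graphs are finite, simple and undirected; $\wedge$ denotes minimum. A fuzzy incidence graph (FIG) $X=(V,E,I,\varepsilon,\rho,\eta)$ consists of a nonempty finite vertex set $V$, a set $E$ of edges $xy=yx$ ($x\neq y$ in $V$), a set $I$ of (incidence) pairs $(x,xy)$ with $xy\in E$ and $x$ an endpoint of $xy$, and functions $\varepsilon:V\to(0,1]$, $\rho:E\to(0,1]$, $\eta:I\to(0,1]$ with $\rho(xy)\le\varepsilon(x)\wedge\varepsilon(y)$ for all $xy\in E$ and $\eta(x,xy)\le\varepsilon(x)\wedge\rho(xy)$ for all $(x,xy)\in I$ (vertices, edges, pairs of weight $0$ are regarded as absent). The number $\eta(x,xy)$ is the weight of the pair $(x,xy)$. Strong pairs. For $(a,ab)\in I$, an incidence path from $a$ to $ab$ in $X\setminus(a,ab)$ is a sequence $x_0=a,(x_0,x_0x_1),x_0x_1,(x_1,x_0x_1),x_1,\dots,x_k=b,(b,ab),ab$ with $k\ge2$, the vertices $x_0,\dots,x_k$ distinct, and all listed edges in $E$ and pairs in $I$; its incidence strength is the minimum weight of its pairs. $ICONN_{X\setminus(a,ab)}(a,ab)$ is the maximum incidence strength over all such paths ($0$ if there are none). The pair $(a,ab)$ is strong if $\eta(a,ab)\ge ICONN_{X\setminus(a,ab)}(a,ab)$. A strong fuzzy incidence graph (SFIG) is a FIG all of whose pairs are strong. Cycles. A cycle in $X$ consists of distinct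 vertices $x_1,\dots,x_k$ ($k\ge 3$), the edges $x_ix_{i+1}\in E$ (indices mod $k$), and the $2k$ pairs $(x_i,x_ix_{i+1}),(x_{i+1},x_ix_{i+1})$, all of which lie in $I$. A cycle is a weak fuzzy incidence cycle (WFIC) if the minimum of $\eta$ over its pairs is not attained at a unique pair of the cycle (i.e. it is attained by at least two of its pairs). *)

(* Defs.v *)
From HB Require Import structures.
From mathcomp Require Import all_boot all_order all_algebra.
Set Implicit Arguments.
Unset Strict Implicit.
Unset Printing Implicit Defensive.
Import Order.TTheory GRing.Theory Num.Theory.
Local Open Scope ring_scope.

(* The edge xy is the two-element set [set x; y] and an incidence pair is      *)
(* (x, [set x; y]).  The weights are total functions; only their values on     *)
(* [edges], resp. [pairs], are constrained and ever used.                      *)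
Record fig (R : realFieldType) (V : finType) := Fig {
  edges : {set {set V}};
  pairs : {set V * {set V}};
  vweight : V -> R;
  eweight : {set V} -> R;
  pweight : V * {set V} -> R;
  fig_nonempty : (0 < #|V|)%N;
  edges_card2 : forall e, e \in edges -> #|e| = 2;
  pairs_incident : forall x e, (x, e) \in pairs -> e \in edges /\ x \in e;
  vweight_itv : forall x, 0 < vweight x <= 1;
  eweight_itv : forall e, e \in edges -> 0 < eweight e <= 1;
  pweight_itv : forall q, q \in pairs -> 0 < pweight q <= 1;
  eweight_le : forall x y, [set x; y] \in edges ->
    eweight [set x; y] <= Num.min (vweight x) (vweight y);
  pweight_le : forall x e, (x, e) \in pairs ->
    pweight (x, e) <= Num.min (vweight x) (eweight e)
}.

Section FuzzyIncidenceGraph.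
Variables (R : realFieldType) (V : finType) (X : fig R V).
Implicit Types (x y a b : V) (p c : seq V).

(* Pair weights are at most 1, so the default 1 never affects the minimum over *)
(* a nonempty list of pairs of X.                                              *)
Definition min_pweight (s : seq (V * {set V})) : R :=
  \big[Num.min/1]_(q <- s) pweight X q.

Definition step_pairs x y : seq (V * {set V}) :=
  [:: (x, [set x; y]); (y, [set x; y])].

Definition inc_step : rel V := fun x y =>
  ([set x; y] \in edges X) && all (fun q => q \in pairs X) (step_pairs x y).

(* An incidence path x_0 = a, ..., x_k = b, (b, ab), ab is represented by its  *)
(* vertices a :: p with p = [:: x_1; ...; x_k]; since the graph is simple,     *)
(* these determine the edges and pairs.  As k >= 2 and the x_i are distinct,   *)
(* the pair (a, ab) does not occur in it.                                      *)
Definition inc_path a b p : bool :=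
  [&& (2 <= size p)%N, uniq (a :: p), last a p == b, path inc_step a p,
      [set a; b] \in edges X & (b, [set a; b]) \in pairs X].

Definition inc_path_pairs a b p : seq (V * {set V}) :=
  rcons (flatten (pairmap step_pairs a p)) (b, [set a; b]).

Definition inc_strength a b p : R := min_pweight (inc_path_pairs a b p).

(* Distinctness of the vertices forces size p < #|V|, so k ranges over all     *)
(* possible lengths; strengths are positive, so the default 0 is the value     *)
(* only when there is no path.                                                 *)
Definition iconn a b : R :=
  \big[Num.max/0]_(k < #|V|)
    \big[Num.max/0]_(p : k.-tuple V | inc_path a b p) inc_strength a b p.

Definition strong_pair a b : Prop := pweight X (a, [set a; b]) >= iconn a b.

Definition sfig : Prop :=
  forall a b, (a, [set a; b]) \in pairs X -> strong_pair a b.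

Definition is_cycle c : bool :=
  [&& (3 <= size c)%N, uniq c & cycle inc_step c].

Definition cycle_pairs c : seq (V * {set V}) :=
  flatten [seq step_pairs x (next c x) | x <- c].

Definition wfic c : Prop :=
  is_cycle c /\
  (1 < #|[set q in cycle_pairs c
          | pweight X q == min_pweight (cycle_pairs c)]|)%N.

End FuzzyIncidenceGraph.

(* Main.v *)
(* Closing an incidence path from a to ab by the pair (a,ab) yields a cycle,   *)
(* and every pair of every cycle, up to rotation and reversal, arises as the   *)
(* closing pair of such a path.  Hence (a,ab) is strong iff on each cycle      *)
(* through it some other pair is at most as heavy, and this holds for all      *)
(* pairs of a cycle iff its minimum weight is attained at least twice.         *)
Require Import Defs.
From HB Require Import structures.
From mathcomp Require Import all_boot all_order all_algebra.
Set Implicit Arguments.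
Unset Strict Implicit.
Unset Printing Implicit Defensive.
Import Order.TTheory GRing.Theory Num.Theory.
Local Open Scope ring_scope.

(** Both notions reduce to a pair having a rival, another pair that is at most as heavy. By [wficP],
    a cycle is a WFIC iff each of its pairs has a rival on the cycle; by [strong_pairP], [(a, ab)]
    is strong iff every incidence path from [a] to [ab] contains a pair at most as heavy. The two
    conditions match because the cycle [a :: p] consists of the path [p] and the closing pair
    [(a, ab)] ([cycle_pairs_inc_path]), which is not on the path ([closing_pair_notin]): rivals on
    the cycle are exactly the path pairs that are at most as heavy. By [cycle_pair_last], any pair
    of a cycle can be made the closing one. *)

Lemma map_next_pairmap (T : eqType) (S : Type) (f : T -> T -> S) a (p : seq T) :
  uniq (a :: p) ->
  [seq f x (next (a :: p) x) | x <- a :: p] = pairmap f a (rcons p a).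
Proof.
move=> Up; have szE : size (pairmap f a (rcons p a)) = (size p).+1.
  by rewrite size_pairmap size_rcons.
apply: (@eq_from_nth _ (f a a)) => [|i]; rewrite size_map ?szE // => ltip.
rewrite (nth_map a) // (nth_pairmap a) ?size_rcons //.
rewrite next_nth mem_nth // index_uniq //; congr (f _ _).
  rewrite -rcons_cons nth_rcons ltip //; exact: set_nth_default.
rewrite nth_rcons; case: ltnP => // le_pi.
by rewrite nth_default // if_same.
Qed.

Section IncidenceCycles.
Variables (R : realFieldType) (V : finType) (X : fig R V).
Implicit Types (a b x y : V) (p c : seq V) (q : V * {set V}).
Implicit Types (s : seq (V * {set V})).

Lemma min_pweight_le s q : q \in s -> min_pweight X s <= pweight X q.
Proof.
rewrite /min_pweight; elim: s => // q' s IHs.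
rewrite inE big_cons ge_min => /predU1P[->|/IHs ->]; first by rewrite lexx.
by rewrite orbT.
Qed.

Lemma min_pweight_attained s :
    s != [::] -> {subset s <= pairs X} ->
  exists2 q, q \in s & pweight X q = min_pweight X s.
Proof.
rewrite /min_pweight; elim: s => // q s IHs _ sX; rewrite big_cons.
have [s0|s_neq0] := eqVneq s [::].
  (* The default 1 enters the minimum here; it is harmless because pair weights are at most 1. *)
  exists q; rewrite ?mem_head // s0 big_nil min_l //.
  by have /andP[] := pweight_itv (sX _ (mem_head q s)).
have [|q' q's <-] := IHs s_neq0.
  by move=> q' q's; apply: sX; rewrite inE q's orbT.
have [_|_] := leP (pweight X q) (pweight X q').
  by exists q; rewrite ?mem_head.
by exists q'; rewrite // inE q's orbT.
Qed.

(** A rival of a lightest pair is lightest too, which gives the second minimizer. Conversely, of two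
    minimizers at least one differs from any given [q]. *)
Lemma min_pweight_attained_twiceP s :
    s != [::] -> {subset s <= pairs X} ->
  (1 < #|[set q in s | pweight X q == min_pweight X s]|)%N <->
  forall q, q \in s ->
    exists2 q', q' \in s & q' != q /\ pweight X q' <= pweight X q.
Proof.
move=> s_neq0 sX; split=> [/card_gt1P[q1 [q2 []]] | other].
  rewrite !inE => /andP[q1s /eqP w1] /andP[q2s /eqP w2] q12 q qs.
  have [q1q|q1q] := eqVneq q1 q.
    by exists q2; rewrite // w2 min_pweight_le // -q1q eq_sym.
  by exists q1; rewrite // w1 min_pweight_le.
have [q qs wq] := min_pweight_attained s_neq0 sX.
have [q' q's [q'q le_w]] := other q qs.
apply/card_gt1P; exists q, q'; rewrite !inE qs q's wq eqxx /= (eq_sym q) q'q.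
by split=> //; rewrite eq_le min_pweight_le // andbT -wq.
Qed.

Lemma inc_step_sym : symmetric (inc_step X).
Proof.
by move=> x y; rewrite /inc_step /= setUC !andbT; congr andb; rewrite andbC.
Qed.

Lemma inc_step_pairs x y : inc_step X x y -> {subset step_pairs x y <= pairs X}.
Proof. by case/andP=> _ /allP. Qed.

Lemma step_pairsC x y : step_pairs x y =i step_pairs y x.
Proof. by move=> q; rewrite /step_pairs setUC !inE orbC. Qed.

Lemma cycle_pairsP c q :
  reflect (exists2 x, x \in c & q \in step_pairs x (next c x))
          (q \in cycle_pairs c).
Proof. exact: flatten_mapP. Qed.

Lemma cycle_pairs_sub c : is_cycle X c -> {subset cycle_pairs c <= pairs X}.
Proof.
case/and3P=> _ _ cyc q /cycle_pairsP[x xc]; apply: inc_step_pairs.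
exact: next_cycle xc.
Qed.

Lemma cycle_pairs_neq0 c : is_cycle X c -> cycle_pairs c != [::].
Proof. by case: c. Qed.

Lemma wficP c : is_cycle X c ->
  wfic X c <->
  forall q, q \in cycle_pairs c ->
    exists2 q', q' \in cycle_pairs c & q' != q /\ pweight X q' <= pweight X q.
Proof.
move=> cyc.
have [tw1 tw2] :=
  min_pweight_attained_twiceP (cycle_pairs_neq0 cyc) (cycle_pairs_sub cyc).
by split=> [[_ /tw1]|/tw2].
Qed.

Lemma is_cycle_rot n c : is_cycle X (rot n c) = is_cycle X c.
Proof. by rewrite /is_cycle size_rot rot_uniq rot_cycle. Qed.

Lemma is_cycle_rev c : is_cycle X (rev c) = is_cycle X c.
Proof.
rewrite /is_cycle size_rev rev_uniq rev_cycle; do 2!congr andb.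
by apply: eq_cycle => x y; rewrite inc_step_sym.
Qed.

Lemma cycle_pairs_rot n c : uniq c -> cycle_pairs (rot n c) =i cycle_pairs c.
Proof.
move=> Uc q; apply/cycle_pairsP/cycle_pairsP=> -[x];
  by rewrite ?next_rot ?mem_rot //; exists x; rewrite ?next_rot ?mem_rot.
Qed.

(** The step leaving [x] in [c] is, traversed backwards, the step leaving [next c x] in [rev c]; its
    two pairs are swapped, so only membership is preserved. *)
Lemma cycle_pairs_rev c : uniq c -> cycle_pairs (rev c) =i cycle_pairs c.
Proof.
move=> Uc q; apply/cycle_pairsP/cycle_pairsP=> -[x].
  rewrite mem_rev next_rev // => xc qx; exists (prev c x).
    by rewrite mem_prev.
  by rewrite next_prev // step_pairsC.
move=> xc qx; exists (next c x); first by rewrite mem_rev mem_next.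
by rewrite next_rev // prev_next // step_pairsC.
Qed.

Lemma inc_path_is_cycle a b p :
  (a, [set a; b]) \in pairs X -> inc_path X a b p -> is_cycle X (a :: p).
Proof.
move=> abX /and5P[sz Up /eqP lastb pth /andP[abE bX]].
rewrite /is_cycle Up /= ltnS sz /= rcons_path pth lastb /=.
by rewrite inc_step_sym /inc_step abE /= abX bX.
Qed.

Lemma is_cycle_inc_path a p :
  is_cycle X (a :: p) -> inc_path X a (last a p) p.
Proof.
case/and3P=> sz Up; rewrite /= rcons_path => /andP[pth].
rewrite inc_step_sym => /and3P[abE _ /andP[bX _]].
by rewrite /inc_path Up eqxx pth abE bX -ltnS sz.
Qed.

Lemma cycle_pairs_inc_path a p : uniq (a :: p) ->
  cycle_pairs (a :: p) =
  rcons (inc_path_pairs a (last a p) p) (a, [set a; last a p]).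
Proof.
move=> Up; rewrite /cycle_pairs map_next_pairmap // -cats1 pairmap_cat.
rewrite flatten_cat /= /inc_path_pairs -!cats1 -catA /step_pairs.
by rewrite setUC.
Qed.

Lemma flatten_pairmap_step_pairsP x p q :
  q \in flatten (pairmap (@step_pairs V) x p) -> q.1 \in x :: p.
Proof.
elim: p x => //= y p IHp x; rewrite !inE.
case/or3P=> [/eqP->|/eqP->|/IHp]; rewrite ?eqxx ?orbT //.
by rewrite inE => ->; rewrite orbT.
Qed.

Lemma closing_pair_notin a b p :
  inc_path X a b p -> (a, [set a; b]) \notin inc_path_pairs a b p.
Proof.
case: p => [|x p] /and5P[//= sz Up /eqP lastb _ _].
have bp : b \in p by case: p sz lastb {Up} => //= y p _ <-; exact: mem_last.
have [ap ax xp] : [/\ a \notin x :: p, a != x & x \notin p].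
  case/andP: Up => ap /andP[xp _]; split=> //.
  by move: ap; rewrite inE negb_or => /andP[].
have ab : a != b by apply: contraNneq ap => ->; rewrite inE bp orbT.
rewrite mem_rcons /= !inE !xpair_eqE (negPf ab) (negPf ax) /=.
(* In the first step, [(a, ax)] could only be the closing pair if [x = b], but the path has length
   at least 2, so [b] comes after [x]. Pairs of later steps sit at vertices other than [a]. *)
rewrite negb_or; apply/andP; split.
  apply: contra xp => /andP[_ /eqP/setP/(_ b)].
  by rewrite !inE eqxx orbT [b == a]eq_sym (negPf ab) => /esym/eqP <-.
by apply: contra ap => /flatten_pairmap_step_pairsP.
Qed.

Lemma rot_to_next c x : is_cycle X c -> x \in c ->
  exists p, [/\ last (next c x) p = x, is_cycle X (next c x :: p)
    & cycle_pairs (next c x :: p) =i cycle_pairs c].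
Proof.
move=> cyc xc; have Uc : uniq c by case/and3P: cyc.
have [n s def_c] := rot_to xc.
rewrite -(next_rot n Uc) def_c.
have cycr : is_cycle X (x :: s) by rewrite -def_c is_cycle_rot.
have eq_pairs : cycle_pairs (x :: s) =i cycle_pairs c.
  by rewrite -def_c; exact: cycle_pairs_rot.
case: s cycr eq_pairs {def_c} => [|y s] cycr eq_pairs; first by case/and3P: cycr.
have Ur : uniq [:: x, y & s] by case/and3P: cycr.
(* One more rotation moves [x] from the front to the end, so that the edge from [x] to its successor
   closes the cycle. *)
rewrite /= eqxx; exists (rcons s x).
have -> : y :: rcons s x = rot 1 [:: x, y & s] by rewrite rot1_cons.
split; rewrite ?last_rcons ?is_cycle_rot // => q.
by rewrite cycle_pairs_rot.
Qed.

Lemma cycle_pair_last c q : is_cycle X c -> q \in cycle_pairs c ->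
  exists a p, [/\ q = (a, [set a; last a p]), is_cycle X (a :: p)
    & cycle_pairs (a :: p) =i cycle_pairs c].
Proof.
move=> cyc /cycle_pairsP[x xc]; have Uc : uniq c by case/and3P: cyc.
(* A pair at the far end [next c x] becomes the closing pair by rotation alone; a pair at [x]
   requires reversing the cycle first, after which [x] follows [next c x]. *)
rewrite !inE => /orP[]/eqP->; last first.
  have [p [lastp cycp eq_pairs]] := rot_to_next cyc xc.
  by exists (next c x), p; rewrite lastp setUC.
have cycr : is_cycle X (rev c) by rewrite is_cycle_rev.
have nxc : next c x \in rev c by rewrite mem_rev mem_next.
have [p] := rot_to_next cycr nxc.
rewrite next_rev // prev_next // => -[lastp cycp eq_pairs].
by exists x, p; rewrite lastp; split=> // q'; rewrite eq_pairs cycle_pairs_rev.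
Qed.

Lemma inc_path_pairs_sub a b p :
  inc_path X a b p -> {subset inc_path_pairs a b p <= pairs X}.
Proof.
case/and5P=> _ _ _ pth /andP[_ bX] q; rewrite mem_rcons inE => /predU1P[-> //|].
elim: p a pth {bX} => //= y p IHp x /andP[xy pth].
rewrite -[_ :: _]/(step_pairs x y ++ flatten (pairmap (@step_pairs V) y p)).
by rewrite mem_cat => /orP[/(inc_step_pairs xy)|/(IHp y pth)].
Qed.

(** Nonnegativity of [w] absorbs the default 0 of both maxima, which covers the case of no path. *)
Lemma iconn_leP a b (w : R) : 0 <= w ->
  iconn X a b <= w <-> forall p, inc_path X a b p -> inc_strength X a b p <= w.
Proof.
move=> w_ge0; split=> [le_w p pP | le_w].
  have ltp : (size p < #|V|)%N.
    case/and5P: pP => _ Up _ _ _.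
    by have := max_card (mem (a :: p)); rewrite (card_uniqP Up).
  apply: le_trans le_w; rewrite /iconn.
  apply: (bigmax_sup (Ordinal ltp)) => //.
  exact: (@bigmax_sup _ _ _ _ (in_tuple p)).
by apply: bigmax_le => // k _; apply: bigmax_le => // p /le_w.
Qed.

Lemma strong_pairP a b : (a, [set a; b]) \in pairs X ->
  strong_pair X a b <->
  forall p, inc_path X a b p ->
    exists2 q, q \in inc_path_pairs a b p &
      pweight X q <= pweight X (a, [set a; b]).
Proof.
move=> abX; have w_ge0 : 0 <= pweight X (a, [set a; b]).
  by have /andP[/ltW] := pweight_itv abX.
have [iconn1 iconn2] := iconn_leP a b w_ge0.
split=> [/iconn1 le_w p pP | ex_le]; last first.
  by apply: iconn2 => p /ex_le[q qp]; apply: le_trans; exact: min_pweight_le.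
have neq0 : inc_path_pairs a b p != [::].
  by rewrite -size_eq0 size_rcons.
have [q qp wq] := min_pweight_attained neq0 (inc_path_pairs_sub pP).
by exists q; rewrite // wq le_w.
Qed.

End IncidenceCycles.

Theorem theorem3p4 (R : realFieldType) (V : finType) (X : fig R V) :
  sfig X <-> (forall c : seq V, is_cycle X c -> wfic X c).
Proof.
split=> [strongX c cyc | weakX a b abX].
  apply/wficP => // q qc.
  have [a [p [def_q cycp eq_pairs]]] := cycle_pair_last cyc qc.
  have Up : uniq (a :: p) by case/and3P: cycp.
  have pP := is_cycle_inc_path cycp.
  have abX : (a, [set a; last a p]) \in pairs X.
    by rewrite -def_q (cycle_pairs_sub cyc).
  have [/(_ (strongX _ _ abX) _ pP)[q' q'p le_w] _] := strong_pairP abX.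
  exists q'.
    by rewrite -eq_pairs cycle_pairs_inc_path // mem_rcons inE q'p orbT.
  (* The pair found lies on the path, hence differs from the closing pair. *)
  rewrite def_q; split=> //; apply: contraTneq q'p => ->.
  exact: closing_pair_notin pP.
apply/strong_pairP => // p pP.
have cycp := inc_path_is_cycle abX pP.
have Up : uniq (a :: p) by case/and3P: cycp.
have lastp : last a p = b by case/and5P: pP => _ _ /eqP.
have [/(_ (weakX _ cycp)) + _] := wficP cycp.
rewrite cycle_pairs_inc_path // lastp => /(_ (a, [set a; b])).
case=> [|q]; first by rewrite mem_rcons mem_head.
(* The rival is not the closing pair itself, so it lies on the path. *)
by rewrite mem_rcons inE => /predU1P[->|qp] [neq le_w]; [rewrite eqxx in neq|exists q].
Qed.
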